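(* Let $n\ge2$ be an integer. There exists a point $(x,\mathbf{a})\in\mathbb{R}^{n+1}$, $\mathbf{a}=(a_2,\dots,a_{n+1})$, such that \[ x\ge n,\quad \mathbf{a}\in\mathcal{A}(x),\quad F_n=F(x,\mathbf{a}). \] Moreover, every such point has the following properties: \begin{enumerate} \item there exists $\ell\in\{2,\dots,n\}$ such that $F_n=2(x-n)+\ell-1$ and $x=(2-\theta)F_n$, where $\theta=\big(F_n/(F_n+1)\big)^{n+1-\ell}$; \item $a_2=\cdots=a_\ell=1$ and $a_k=2-\big(F_n/(F_n+1)\big)^{k-\ell}$ for $k=\ell,\dots,n+1$; \item $F_n=\dfrac{A_{\ell+1}(x,\mathbf{a})}{a_{\ell+1}}=\cdots=\dfrac{A_{n+1}(x,\mathbf{a})}{a_{n+1}}$. \end{enumerate}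
   Context: For real $x\ge n$ let $\mathcal{A}(x)=\{\mathbf{a}=(a_2,\dots,a_{n+1})\in\mathbb{R}^n:\ 1=a_2\le\cdots\le a_{n+1},\ a_2+\cdots+a_{n+1}=x\}$. For $\mathbf{a}\in\mathcal{A}(x)$ and $2\le k\le n+1$ let $A_k(x,\mathbf{a})=2x-2(n-k+1)-\sum_{i=2}^k a_i$, $F(x,\mathbf{a})=\max_{2\le k\le n+1}A_k(x,\mathbf{a})/a_k$, $F(x)=\min_{\mathbf{a}\in\mathcal{A}(x)}F(x,\mathbf{a})$, and $F_n=\inf_{x\ge n}F(x)$. *)

(* Defs.v *)
From HB Require Import structures.
From mathcomp Require Import all_boot all_order all_algebra.
From mathcomp Require Import all_classical all_reals all_analysis.
From mathcomp Require Import zify ring lra.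
Set Implicit Arguments.
Unset Strict Implicit.
Unset Printing Implicit Defensive.
Import Order.TTheory GRing.Theory Num.Theory.
Import numFieldNormedType.Exports.
Local Open Scope classical_set_scope.
Local Open Scope ring_scope.

(* The coordinates of a vector a = (a_2, ..., a_{n+1}) are numbered from 2:
   [entry a k] is a_k for 2 <= k <= n + 1.  Its other values are irrelevant. *)
Definition entry (R : realType) (n : nat) (a : 'rV[R]_n) (k : nat) : R :=
  if insub (k - 2)%N is Some i then a ord0 i else 0.

Definition calA (R : realType) (n : nat) (x : R) : set 'rV[R]_n :=
  [set a | [/\ entry a 2 = 1,
               forall k : nat, (2 <= k <= n)%N -> entry a k <= entry a k.+1
             & \sum_(2 <= i < n.+2) entry a i = x]].
Arguments calA {R} n x _.

(* The subtraction n - k + 1 is taken in R, not in nat. *)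
Definition A_ (R : realType) (n : nat) (x : R) (a : 'rV[R]_n) (k : nat) : R :=
  2 * x - 2 * (n%:R - k%:R + 1) - \sum_(2 <= i < k.+1) entry a i.

(* R has no least element, so the iterated maximum starts from its own k = 2
   term. *)
Definition Fxa (R : realType) (n : nat) (x : R) (a : 'rV[R]_n) : R :=
  \big[Num.max/A_ x a 2 / entry a 2]_(2 <= k < n.+2) (A_ x a k / entry a k).

(* This infimum is a minimum: see [Fx_min] below. *)
Definition Fx (R : realType) (n : nat) (x : R) : R :=
  inf [set Fxa x a | a in calA n x].

Definition Fn (R : realType) (n : nat) : R :=
  inf [set Fx n x | x in [set x : R | n%:R <= x]].

Section wellposed.
Variables (R : realType) (n : nat).
Implicit Types (x : R) (a : 'rV[R]_n).

Lemma entryE a (i : 'I_n) : entry a i.+2 = a ord0 i.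
Proof. by rewrite /entry subn2 /= valK. Qed.

Lemma entry_continuous k : continuous (fun a : 'rV[R]_n => entry a k).
Proof.
move=> a; rewrite /entry; case: (insub _ : option 'I_n) => [i|].
  exact: coord_continuous.
exact: (@cst_continuous _ _ (0 : R)).

Qed.

Lemma sum_entry_continuous m p :
  continuous (fun a : 'rV[R]_n => \sum_(m <= i < p) entry a i).
Proof.
move=> a; apply: (@continuous_big) => [|i _]; last exact: entry_continuous.
exact: add_continuous.
Qed.

Lemma entry_ge1 x a k : calA n x a -> (2 <= k <= n.+1)%N -> 1 <= entry a k.
Proof.
case=> a1 amono _; elim: k => [//|k IH] /andP[k2 kn].
have [k1|k1] := leqP k 1.
  by have -> : k = 1%N; [lia|rewrite a1].
by rewrite (le_trans (IH _)) ?amono //; lia.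
Qed.

Lemma entry_le x a k : calA n x a -> (2 <= k <= n.+1)%N -> entry a k <= x.
Proof.
move=> Aa kn; have [_ _ <-] := Aa.
rewrite (big_cat_nat (n := k)) /=; [|lia|lia].
rewrite [X in _ + X]big_ltn; last lia.
rewrite addrCA lerDl addr_ge0 // big_nat_cond sumr_ge0 // => i /andP[ik _];
  by rewrite (le_trans ler01) // (entry_ge1 Aa) //; lia.
Qed.

Lemma calA_nonempty x : (2 <= n)%N -> n%:R <= x -> calA n x !=set0.
Proof.
move=> n2 nx; exists (\row_i if i.+1 == n :> nat then x - n%:R + 1 else 1).
set a := \row__ _.
have ak k : (2 <= k <= n.+1)%N ->
    entry a k = if k == n.+1 then x - n%:R + 1 else 1.
  case: k => [|[|k]] //= kn; have kn' : (k < n)%N by lia.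
  by rewrite (entryE a (Ordinal kn')) mxE eqSS.
split.
- by rewrite ak //; [case: eqP => //; lia|lia].
- move=> k kn; rewrite !ak; [|lia|lia].
  by do 2!case: eqP; rewrite ?lexx //; try lia; move=> *; lra.
- rewrite big_nat_recr /=; last lia.
  rewrite ak ?eqxx; last lia.
  rewrite (eq_big_nat _ _ (F2 := fun=> 1)) => [|i ik]; last first.
    by rewrite ak; [case: eqP => //; lia|lia].
  rewrite big_const_nat iter_addr_0 (_ : (n.+1 - 2 = n.-1)%N); last lia.
  by rewrite -[n in x - n%:R](@prednK n) -?natr1; [ring|lia].
Qed.

Lemma calA_compact x : compact (calA n x : set 'rV[R]_n).
Proof.
apply: (@subclosed_compact _ _
  [set v : 'rV[R]_n | forall i : 'I_n, `[1, x]%classic (v ord0 i)]).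
- rewrite (_ : calA n x = [set a | entry a 2 = 1] `&`
    (\bigcap_(k in [set k | (2 <= k <= n)%N]) [set a | 0 <= entry a k.+1 - entry a k])
    `&` [set a | \sum_(2 <= i < n.+2) entry a i = x]).
    apply: closedI; first apply: closedI.
    + apply: (closed_comp _ (@closed_eq R^o 1)) => a _; exact: entry_continuous.
    + apply: closed_bigI => k _.
      apply: (closed_comp _ (@closed_ge R 0)) => a _.
      by apply: (@continuousB R R^o _ (fun b : 'rV[R]_n => entry b k.+1)
        (fun b : 'rV[R]_n => entry b k)); exact: entry_continuous.
    + apply: (closed_comp _ (@closed_eq R^o x)) => a _.
      exact: sum_entry_continuous.
  apply/seteqP; split => a /=.
    by move=> [a1 am ax]; do 2?split => //; move=> k /= kn; rewrite subr_ge0 am.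
  by move=> [[a1 am] ax]; split => // k kn; have := am k kn; rewrite /= subr_ge0.
- apply: (@rV_compact R n (fun=> `[1, x]%classic)) => _.
  exact: segment_compact.
- move=> a Aa i; rewrite /= in_itv /= -entryE.
  by rewrite (entry_ge1 Aa) ?(entry_le Aa) //; have := ltn_ord i; lia.
Qed.

Lemma Fxa_continuous x : (2 <= n)%N -> {within calA n x, continuous (@Fxa R n x)}.
Proof.
move=> n2; apply: continuous_in_subspaceT => a /set_mem Aa.
have cont k : (2 <= k < n.+2)%N ->
    {for a, continuous (fun b : 'rV[R]_n => A_ x b k / entry b k)}.
  move=> kn.
  apply: (@continuousM R _ (fun b : 'rV[R]_n => A_ x b k)
    (fun b : 'rV[R]_n => (entry b k)^-1)).
    apply: (@continuousB R R^o _
      (fun=> 2 * x - 2 * (n%:R - k%:R + 1))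
      (fun b : 'rV[R]_n => \sum_(2 <= i < k.+1) entry b i)).
      exact: cst_continuous.
    exact: sum_entry_continuous.
  apply: continuousV; last exact: entry_continuous.
  by rewrite gt_eqF // (lt_le_trans ltr01) // (entry_ge1 Aa).
rewrite /Fxa.
have : {subset index_iota 2 n.+2 <= index_iota 2 n.+2} by [].
elim: {1 3}(index_iota 2 n.+2) => [_|k s IH sub].
  by under eq_fun do rewrite big_nil; apply: cont; lia.
under eq_fun do rewrite big_cons.
apply: (@continuous_max R _ (fun b : 'rV[R]_n => A_ x b k / entry b k)
  (fun b : 'rV[R]_n => \big[Num.max/A_ x b 2 / entry b 2]_(i <- s)
    (A_ x b i / entry b i))).
  by apply: cont; have := sub k (mem_head _ _); rewrite mem_index_iota.
by apply: IH => i is_; apply: sub; rewrite inE is_ orbT.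
Qed.

Lemma Fxa_ge1 x a : n%:R <= x -> calA n x a -> 1 <= Fxa x a.
Proof.
move=> nx [a1 _ _]; apply: (le_trans _ (bigmax_ge_id _ _ _ _)).
by rewrite /A_ big_nat1 a1 divr1; lra.
Qed.

Lemma Fx_min x : (2 <= n)%N -> n%:R <= x ->
  exists2 a, calA n x a & Fxa x a = Fx n x /\
    forall b, calA n x b -> Fxa x a <= Fxa x b.
Proof.
move=> n2 nx.
have [a /set_mem Aa amin] := compact_EVT_min (calA_nonempty n2 nx)
  (@calA_compact x) (@Fxa_continuous x n2).
exists a => //; split; last by move=> b Ab; apply: amin; exact/mem_set.
apply/eqP; rewrite eq_le; apply/andP; split.
  apply: lb_le_inf; first by exists (Fxa x a), a.
  by move=> _ [b Ab <-]; apply: amin; exact/mem_set.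
apply: ge_inf; last by exists a.
by exists 1 => _ [b Ab <-]; exact: Fxa_ge1.
Qed.

Lemma Fn_has_inf : (2 <= n)%N ->
  has_inf [set Fx n x | x in [set x : R | n%:R <= x]].
Proof.
move=> n2; split; first by exists (Fx n (n%:R : R)), n%:R => //=.
exists 1 => _ [x nx <-]; have [a Aa [<- _]] := Fx_min n2 nx.
exact: Fxa_ge1.
Qed.

End wellposed.

(* Main.v *)
Require Import Defs.
From mathcomp Require Import all_boot all_order all_algebra.
From mathcomp Require Import all_classical all_reals all_analysis.
From mathcomp Require Import zify ring lra.
Set Implicit Arguments.
Unset Strict Implicit.
Unset Printing Implicit Defensive.
Import Order.TTheory GRing.Theory Num.Theory.
Import numFieldNormedType.Exports.
Local Open Scope classical_set_scope.
Local Open Scope ring_scope.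

(* Write t for F_n, y = x - n and q = t / (t + 1).  In terms of the partial
   sums S_k = a_2 + ... + a_k, the constraint A_(k+1) <= t a_(k+1) reads
   (t + 1) S_(k+1) >= t S_k + 2 (y + k).  Let l be the integer with
   l - 1 <= t - 2 y < l.  Iterating the constraints from S_l >= l - 1 bounds
   S_k below by the sequence T_k for which they are equalities, so
   gap(l, y, t) := y + n - T_(n+1) >= 0.  Conversely, whenever the gap is
   nonnegative and y >= 0, the sequence T, with its last term raised to y + n,
   comes from an admissible vector, so F_n <= t.  If gap > 0, there is room to
   decrease t; hence gap = 0 at an optimum and S is the tight sequence.  Since
   gap is affine in y with slope 2 q^(n+1-l) - 1, it could be made positive by
   moving y if l - 1 < t - 2 y, unless the slope vanishes; in that case gap = 0
   makes t half-integral, which contradicts q^(n+1-l) = 1/2 by comparing 2-adic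
   valuations.  Hence t = 2 y + l - 1, and the formulas follow.  A minimum
   exists by compactness, since F(x, a) >= 2 (x - n) + 1 bounds x. *)

Lemma prime_mul_expn_eq_expn (q p m j : nat) :
  prime q -> (0 < p)%N -> (q * p ^ j = m ^ j)%N -> j = 1%N.
Proof.
move=> q_prime p_gt0 /(congr1 (logn q)).
rewrite lognM ?expn_gt0 ?p_gt0 ?prime_gt0 // !lognX logn_prime // eqxx => val.
apply/eqP; rewrite -dvdn1 -(@dvdn_addl (j * logn q p)) ?dvdn_mulr //.
by rewrite val dvdn_mulr.
Qed.

Lemma continuous_bigmax (R : realType) (T : topologicalType) (I : eqType)
    (s : seq I) (f0 : T -> R) (f : I -> T -> R) (b : T) :
  continuous_at b f0 -> (forall i, i \in s -> continuous_at b (f i)) ->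
  continuous_at b (fun c => \big[Num.max/f0 c]_(i <- s) f i c).
Proof.
move=> f0_cont; elim: s => [|i s IHs] f_cont.
  by under eq_fun do rewrite big_nil.
under eq_fun do rewrite big_cons.
apply: (@continuous_max R _ (f i)); first exact/f_cont/mem_head.
by apply: IHs => k ks; apply: f_cont; rewrite inE ks orbT.
Qed.

Section tight_sequences.
Variable R : realFieldType.
Implicit Types (y t : R) (s : nat -> R) (l k n : nat).

(* For the partial sums [s k = a_2 + ... + a_k], this is
   [t * a_(k+1) - A_(k+1)] with [y = x - n]. *)
Definition slack t y s k : R :=
  (t + 1) * s k.+1 - t * s k - 2 * (y + k%:R).

Definition ratio t : R := t / (t + 1).

Lemma ratio_itv t : 0 < t -> 0 < ratio t < 1.
Proof.
move=> t0; have t1 : 0 < t + 1 by lra.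
by rewrite /ratio divr_gt0 // ltr_pdivrMr // mul1r; lra.
Qed.

Lemma ratio_exp_itv t k : 0 < t -> 0 < ratio t ^+ k <= 1.
Proof.
by move=> /ratio_itv/andP[q0 q1]; rewrite exprn_gt0 ?exprn_ile1 ?ltW.
Qed.

Lemma ratio_le t t' : 0 < t -> t <= t' -> ratio t <= ratio t'.
Proof.
move=> t0 tt'; rewrite /ratio ler_pdivrMr; last lra.
by rewrite mulrAC ler_pdivlMr; lra.
Qed.

Lemma ratio_half_nat_exp_eq_half (p j : nat) :
  (0 < p)%N -> ratio (p%:R / 2) ^+ j = 1 / 2 -> p = 2%N.
Proof.
move=> p0; have p0' : 0 < p%:R :> R by rewrite ltr0n.
have -> : ratio (p%:R / 2) = p%:R / (p%:R + 2) by rewrite /ratio; field; lra.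
move=> half; have p2 : 0 < (p%:R + 2 : R) ^+ j by rewrite exprn_gt0 //; lra.
have : (2 * p ^ j = (p + 2) ^ j)%N.
  apply/eqP; rewrite -(eqr_nat R) natrM !natrX natrD.
  move: half; rewrite expr_div_n => /(canRL (divfK (lt0r_neq0 p2))) ->.
  by apply/eqP; field.
by move=> E; move: (E); rewrite (prime_mul_expn_eq_expn _ p0 E) // !expn1; lia.
Qed.

Definition tight_coef l y t : R := 2 * t - 2 * y + 1 - l%:R.

Lemma tight_coef_eq l y t : t = 2 * y + l%:R - 1 -> tight_coef l y t = t.
Proof. by rewrite /tight_coef; lra. Qed.

(* The sequence with vanishing slack from its value [l - 1] at [k = l] on; its
   values for [k < l] are junk, as [k - l] is truncated. *)
Definition tight_sum l y t k : R :=
  2 * (k%:R - 1 + y - t) + tight_coef l y t * ratio t ^+ (k - l).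

Lemma tight_sum_start l y t : tight_sum l y t l = l%:R - 1.
Proof. by rewrite /tight_sum /tight_coef subnn expr0; lra. Qed.

Lemma tight_sumS l y t k : 0 < t -> (l <= k)%N ->
  tight_sum l y t k.+1 - tight_sum l y t k =
  2 - tight_coef l y t / (t + 1) * ratio t ^+ (k - l).
Proof.
move=> t0 lk; rewrite /tight_sum subSn // exprS -[k.+1%:R]natr1 /ratio.
by field; rewrite gt_eqF //; lra.
Qed.

Lemma slack_tight_sum l y t k : 0 < t -> (l <= k)%N ->
  slack t y (tight_sum l y t) k = 0.
Proof.
move=> t0 lk; rewrite /slack.
have -> : tight_sum l y t k.+1 = tight_sum l y t k + 2
    - tight_coef l y t / (t + 1) * ratio t ^+ (k - l).
  by rewrite -addrA -tight_sumS // addrC subrK.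
by rewrite /tight_sum /tight_coef; field; rewrite gt_eqF //; lra.
Qed.

Lemma excess_shrink l y t s k : 0 < t -> (l <= k)%N -> 0 <= slack t y s k ->
  ratio t * (s k - tight_sum l y t k) <= s k.+1 - tight_sum l y t k.+1.
Proof.
move=> t0 lk slack_ge0; have := slack_tight_sum y t0 lk.
rewrite /ratio mulrAC ler_pdivrMr; last lra.
by move: slack_ge0; rewrite /slack; lra.
Qed.

Lemma excess_geometric l y t s k m : 0 < t -> (l <= k)%N ->
  (forall i, (k <= i < k + m)%N -> 0 <= slack t y s i) ->
  ratio t ^+ m * (s k - tight_sum l y t k)
    <= s (k + m)%N - tight_sum l y t (k + m).
Proof.
move=> t0 lk; elim: m => [|m IHm] slack_ge0.
  by rewrite addn0 expr0 mul1r.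
rewrite addnS exprS -mulrA.
apply: le_trans (excess_shrink t0 _ _); [|lia|by apply: slack_ge0; lia].
have /andP[q0 _] := ratio_itv t0.
by rewrite ler_pM2l // IHm // => i im; apply: slack_ge0; lia.
Qed.

Definition gap n l y t : R := y + n%:R - tight_sum l y t n.+1.

Lemma gapB n l y y' t :
  gap n l y' t - gap n l y t = (y' - y) * (2 * ratio t ^+ (n.+1 - l) - 1).
Proof. by rewrite /gap /tight_sum /tight_coef; ring. Qed.

Lemma gap_shift_ge n l y t e :
  0 <= e -> 0 < t - 2 * e -> l%:R - 1 <= t - 2 * y ->
  gap n l y t - 3 * e <= gap n l (y - e) (t - 2 * e).
Proof.
move=> e0; set t' := t - 2 * e => t'0 t_range.
have t't : t' <= t by rewrite /t'; lra.
have /andP[q'0 _] := ratio_itv t'0.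
have qq' := ratio_le t'0 t't.
have : tight_coef l (y - e) t' * ratio t' ^+ (n.+1 - l)
    <= tight_coef l y t * ratio t ^+ (n.+1 - l).
  apply: ler_pM; last 2 first.
  - by rewrite /tight_coef /t'; lra.
  - by rewrite lerXn2r // nnegrE ltW //; apply: lt_le_trans qq'.
  - by move: t'0; rewrite /tight_coef /t'; lra.
  - exact/exprn_ge0/ltW.
by rewrite /gap /tight_sum /t'; lra.
Qed.

Lemma gap_eq0_ratio_exp_neq n l y t : (2 <= n)%N -> (l <= n)%N ->
  gap n l y t = 0 -> ratio t ^+ (n.+1 - l) <> 1 / 2.
Proof.
move=> n2 ln gap0 half; have tE : t = (2 * n + 1 - l)%N%:R / 2.
  rewrite natrB ?natrD ?natrM; last lia.
  by move: gap0; rewrite /gap /tight_sum /tight_coef half -[n.+1%:R]natr1; lra.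
have : (2 * n + 1 - l = 2)%N; last lia.
by apply: (@ratio_half_nat_exp_eq_half _ (n.+1 - l)); [lia|rewrite -tE].
Qed.

Definition tight_path l y t k : R :=
  if (k <= l)%N then k%:R - 1 else tight_sum l y t k.

Lemma tight_path_head l y t k : (k <= l)%N -> tight_path l y t k = k%:R - 1.
Proof. by rewrite /tight_path => ->. Qed.

Lemma tight_path_tail l y t k :
  (l <= k)%N -> tight_path l y t k = tight_sum l y t k.
Proof.
rewrite /tight_path => lk; case: ifP => // kl.
have -> : k = l by lia.
by rewrite tight_sum_start.
Qed.

Lemma tight_path_convex l y t k : 0 < t -> l%:R - 1 <= t - 2 * y <= l%:R ->
  tight_path l y t k.+1 - tight_path l y t k
    <= tight_path l y t k.+2 - tight_path l y t k.+1.
Proof.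
move=> t0 t_range; pose c := tight_coef l y t / (t + 1).
have c_itv : 0 <= c <= 1.
  by rewrite /c /tight_coef divr_ge0 /= ?ler_pdivrMr; lra.
have [lk|kl] := leqP l k.
  rewrite !tight_path_tail ?tight_sumS; try lia; try lra.
  rewrite -/c subSn // exprS mulrCA lerD2l lerN2 ler_piMl //.
    by rewrite mulr_ge0 //; have := ratio_exp_itv (k - l) t0; lra.
  by have := ratio_itv t0; lra.
rewrite (tight_path_head y t kl) (tight_path_head y t (ltnW kl)).
rewrite -[k.+1%:R]natr1; have [kl'|lk] := ltnP k.+1 l.
  by rewrite tight_path_head // -[k.+2%:R]natr1 -[k.+1%:R]natr1; lra.
have kE : k.+1 = l by lia.
rewrite tight_path_tail; last lia.
have := tight_sumS y t0 (leqnn l).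
rewrite -/c subnn mulr1 tight_sum_start -kE -natr1; lra.
Qed.

Lemma slack_tight_path_ge0 l y t k : 0 < t -> l%:R - 1 <= t - 2 * y ->
  0 <= slack t y (tight_path l y t) k.
Proof.
move=> t0 t_range; have [lk|kl] := leqP l k.
  by rewrite /slack !tight_path_tail ?leqW // -/(slack _ _ _ _) slack_tight_sum.
rewrite /slack !tight_path_head ?(ltnW kl) //.
have : k.+1%:R <= l%:R :> R by rewrite ler_nat.
by rewrite -natr1; lra.
Qed.

End tight_sequences.

Section partial_sums.
Variables (R : realType) (n : nat).
Implicit Types (x y t : R) (a : 'rV[R]_n) (s : nat -> R) (j k : nat).

Definition psum a k : R := \sum_(2 <= i < k.+1) entry a i.

Lemma psum1 a : psum a 1 = 0.
Proof. by rewrite /psum big_geq. Qed.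

Lemma entry_psum a k : (1 <= k)%N -> entry a k.+1 = psum a k.+1 - psum a k.
Proof.
by move=> k1; rewrite /psum [X in X - _]big_nat_recr //= addrAC subrr add0r.
Qed.

Lemma psum_last x a : calA n x a -> psum a n.+1 = x.
Proof. by case. Qed.

Lemma psumB_ge x a j k : calA n x a -> (1 <= j <= k)%N -> (k <= n.+1)%N ->
  k%:R - j%:R <= psum a k - psum a j.
Proof.
move=> Aa jk kn; rewrite /psum (big_cat_nat (n := j.+1)) /=; [|lia|lia].
rewrite addrAC subrr add0r -natrB; last lia.
rewrite -subSS -sumr_const_nat; apply: ler_sum_nat => i ik.
by apply: (entry_ge1 Aa); lia.
Qed.

Lemma slack_psum t x a k : (1 <= k)%N ->
  slack t (x - n%:R) (psum a) k = t * entry a k.+1 - A_ x a k.+1.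
Proof.
move=> k1; rewrite /slack /A_ -/(psum a k.+1) entry_psum // -[k.+1%:R]natr1.
by ring.
Qed.

Lemma calA_ge x a : calA n x a -> n%:R <= x.
Proof.
move=> Aa; have := psumB_ge (j := 1) (k := n.+1) Aa isT (leqnn _).
by rewrite psum1 (psum_last Aa) -natr1; lra.
Qed.

Definition diff_row s : 'rV[R]_n := \row_(i < n) (s i.+2 - s i.+1).

Lemma entry_diff_row s k :
  (1 <= k <= n)%N -> entry (diff_row s) k.+1 = s k.+1 - s k.
Proof.
case: k => // k kn; have kn' : (k < n)%N by lia.
by rewrite (entryE _ (Ordinal kn')) mxE.
Qed.

Lemma psum_diff_row s k :
  (1 <= k <= n.+1)%N -> psum (diff_row s) k = s k - s 1%N.
Proof.
move=> kn; rewrite /psum big_add1 /=.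
by apply: telescope_sumr_eq => [|i ik]; [lia|rewrite entry_diff_row //; lia].
Qed.

Lemma calA_diff_row s : (0 < n)%N -> s 2%N - s 1%N = 1 ->
  (forall k, (1 <= k < n)%N -> s k.+1 - s k <= s k.+2 - s k.+1) ->
  calA n (s n.+1 - s 1%N) (diff_row s).
Proof.
move=> n_gt0 s1 s_convex; split.
- by rewrite entry_diff_row.
- by case=> // k kn; rewrite !entry_diff_row ?s_convex //; lia.
- by rewrite -/(psum (diff_row s) n.+1) psum_diff_row /=.
Qed.

Lemma psum_continuous k : continuous (fun a => psum a k).
Proof. exact: sum_entry_continuous. Qed.

Lemma compact_calA_le c :
  compact [set a : 'rV[R]_n | calA n (psum a n.+1) a /\ psum a n.+1 <= c].
Proof.
apply: (@subclosed_compact _ _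
  [set a : 'rV[R]_n | forall i : 'I_n, `[1, c]%classic (a ord0 i)]).
- rewrite (_ : [set a | _] = [set a | entry a 2 = 1] `&`
      (\bigcap_(k in [set k | (2 <= k <= n)%N])
        [set a | 0 <= entry a k.+1 - entry a k]) `&`
      [set a | psum a n.+1 <= c]); last first.
    apply/seteqP; split=> a /=.
      move=> [[a1 am _] ac]; do 2?split=> //; move=> k /= /am.
      by rewrite subr_ge0.
    by move=> [[a1 am] ac]; do 2?split=> //; move=> k /am /=; rewrite subr_ge0.
  apply: closedI; first apply: closedI.
  + apply: (closed_comp _ (@closed_eq R^o 1)) => a _.
    exact: entry_continuous.
  + apply: closed_bigI => k _; apply: (closed_comp _ (@closed_ge R 0)) => a _.
    apply: (@continuousB R R^o _ (fun b => entry b k.+1)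
      (fun b => entry b k)); exact: entry_continuous.
  + apply: (closed_comp _ (@closed_le R c)) => a _.
    exact: psum_continuous.
- apply: (@rV_compact R n (fun=> `[1, c]%classic)) => _.
  exact: segment_compact.
- move=> a [Aa ac] i; rewrite /= in_itv /= -entryE.
  have kn : (2 <= i.+2 <= n.+1)%N by have := ltn_ord i; lia.
  by rewrite (entry_ge1 Aa kn) (le_trans (entry_le Aa kn) ac).
Qed.

End partial_sums.

Section optimum.
Variables (R : realType) (n : nat).
Hypothesis n2 : (2 <= n)%N.
Implicit Types (x y t : R) (a : 'rV[R]_n) (s : nat -> R) (k l : nat).

Lemma Fxa_leP x a t : calA n x a ->
  reflect (forall k, (1 <= k <= n)%N -> 0 <= slack t (x - n%:R) (psum a) k)
          (Fxa x a <= t).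
Proof.
move=> Aa; have a_gt0 k : (1 <= k <= n)%N -> 0 < entry a k.+1.
  by move=> kn; rewrite (lt_le_trans ltr01) // (entry_ge1 Aa).
have slackE k : (1 <= k <= n)%N ->
    (0 <= slack t (x - n%:R) (psum a) k) = (A_ x a k.+1 / entry a k.+1 <= t).
  move=> kn; rewrite slack_psum ?subr_ge0 ?ler_pdivrMr ?a_gt0 //; lia.
apply: (iffP idP) => [Ft k kn|slack_ge0].
  rewrite slackE //; apply: le_trans Ft.
  apply: (@le_bigmax_seq _ _ _ (index_iota 2 n.+2) _ k.+1 xpredT
    (fun k => A_ x a k / entry a k)) => //.
  by rewrite mem_index_iota.
rewrite /Fxa big_nat_cond; apply: bigmax_le => [|k /andP[kn _]].
  by rewrite -slackE ?slack_ge0 //= ltnW.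
by case: k kn => // k kn; rewrite -slackE ?slack_ge0.
Qed.

Lemma Fn_le_Fxa x a : n%:R <= x -> calA n x a -> Fn R n <= Fxa x a.
Proof.
move=> nx Aa; apply: (@le_trans _ _ (Fx n x)).
  by apply: ge_inf; [exact: (Fn_has_inf R n2).2|exists x].
have [b Ab [<- bmin]] := Fx_min n2 nx; exact: bmin.
Qed.

Lemma Fxa_ge x a : calA n x a -> 2 * (x - n%:R) + 1 <= Fxa x a.
Proof.
move=> [a1 _ _]; apply: (le_trans _ (bigmax_ge_id _ _ _ _)).
by rewrite /A_ big_nat1 a1 divr1; lra.
Qed.

Lemma Fxa_at_n_ge a : calA n n%:R a -> n%:R <= Fxa n%:R a.
Proof.
move=> Aa; set t := Fxa n%:R a.
have slack_ge0 : 0 <= slack t (n%:R - n%:R) (psum a) n.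
  by apply: (Fxa_leP _ Aa) => //; lia.
have psum_ge : n%:R - 1 <= psum a n.
  have := psumB_ge (j := 1) (k := n) Aa ltac:(lia) (leqnSn n).
  by rewrite psum1 subr0.
have : t * (n%:R - 1) <= t * psum a n.
  by rewrite ler_wpM2l //; have := Fxa_ge Aa; rewrite -/t; lra.
by move: slack_ge0; rewrite /slack (psum_last Aa); lra.
Qed.

Lemma Fn_le_of_slack s t y : 0 <= y -> s 1%N = 0 -> s 2%N = 1 ->
  (forall k, (1 <= k < n)%N -> s k.+1 - s k <= s k.+2 - s k.+1) ->
  (forall k, (1 <= k <= n)%N -> 0 <= slack t y s k) ->
  0 <= t -> s n.+1 <= y + n%:R -> Fn R n <= t.
Proof.
move=> y0 s1 s2 s_convex s_slack t0 s_last.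
pose r k := if k == n.+1 then y + n%:R else s k.
have r_head k : (k <= n)%N -> r k = s k by rewrite /r; case: eqP => //; lia.
have r_last : r n.+1 = y + n%:R by rewrite /r eqxx.
have r_ge k : s k <= r k by rewrite /r; case: eqP => // ->.
have r1 : r 1%N = 0 by rewrite r_head ?s1 // ltnW.
have Ar : calA n (y + n%:R) (diff_row n r).
  rewrite -r_last -[r n.+1]subr0 -r1; apply: calA_diff_row; first exact: ltnW.
    by rewrite r1 r_head // s2 subr0.
  move=> k kn; rewrite (r_head k) ?(r_head k.+1); [|lia|lia].
  by apply: le_trans (s_convex k kn) _; rewrite lerD2r r_ge.
apply: le_trans (Fn_le_Fxa _ Ar) _; first by rewrite lerDr.
apply/(Fxa_leP _ Ar) => k kn; rewrite /slack !psum_diff_row; [|lia|lia].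
rewrite r1 !subr0 addrK (r_head k); last lia.
have := s_slack k kn; rewrite /slack.
have : (t + 1) * s k.+1 <= (t + 1) * r k.+1 by rewrite ler_wpM2l //; lra.
by lra.
Qed.

Lemma Fn_le_of_gap l y t : (2 <= l <= n)%N -> 0 <= y ->
  l%:R - 1 <= t - 2 * y <= l%:R -> 0 <= gap n l y t -> Fn R n <= t.
Proof.
move=> l_range y0 t_range gap0.
have l2 : 2 <= l%:R :> R by rewrite ler_nat; lia.
have t0 : 0 < t by lra.
apply: (@Fn_le_of_slack (tight_path l y t) t y) => // [||k _|k _||].
- by rewrite tight_path_head ?subrr //; lia.
- by rewrite tight_path_head; [lra|lia].
- exact: tight_path_convex.
- by apply: slack_tight_path_ge0 => //; lra.
- exact: ltW.
- by rewrite tight_path_tail; [move: gap0; rewrite /gap; lra|lia].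
Qed.

Lemma Fn_lt_of_gap l y t : (2 <= l <= n)%N -> 0 < y ->
  l%:R - 1 <= t - 2 * y <= l%:R -> 0 < gap n l y t -> Fn R n < t.
Proof.
move=> l_range y0 t_range gap0.
have l2 : 2 <= l%:R :> R by rewrite ler_nat; lia.
(* Lowering y by e and t by 2 e keeps t - 2 y fixed. *)
pose e := Num.min y (gap n l y t / 3).
have e0 : 0 < e by rewrite lt_min y0 divr_gt0.
have ey : e <= y by rewrite ge_min lexx.
have e_gap : e <= gap n l y t / 3 by rewrite ge_min lexx orbT.
apply: (@le_lt_trans _ _ (t - 2 * e)); last lra.
apply: (@Fn_le_of_gap l (y - e)) => //; [lra|lra|].
apply: le_trans (gap_shift_ge _ _ _ _); lra.
Qed.

Lemma gap_Fn_le0 l y : (2 <= l <= n)%N -> 0 < y ->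
  l%:R - 1 <= Fn R n - 2 * y <= l%:R -> gap n l y (Fn R n) <= 0.
Proof.
move=> l_range y0 t_range; rewrite leNgt; apply/negP => gap0.
by have := Fn_lt_of_gap l_range y0 t_range gap0; rewrite ltxx.
Qed.

Lemma Fn_lt_n : Fn R n < n%:R.
Proof.
have n2' : 2 <= n%:R :> R by rewrite ler_nat.
apply: (@Fn_lt_of_gap n (1 / 2)); rewrite ?leqnn ?n2 //; try lra.
rewrite /gap /tight_sum /tight_coef /ratio subSnn expr1 -natr1.
set N := n%:R : R; rewrite -/N in n2'.
rewrite [ltRHS](_ : _ = (N - 1) / (2 * (N + 1))); last by field; lra.
by rewrite divr_gt0; lra.
Qed.

Lemma Fxa_psum_continuous a :
  (forall k, (2 <= k <= n.+1)%N -> entry a k != 0) ->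
  continuous_at a (fun b : 'rV[R]_n => Fxa (psum b n.+1) b).
Proof.
move=> a_neq0; have quotient_continuous k : (2 <= k <= n.+1)%N ->
    continuous_at a (fun b : 'rV[R]_n => A_ (psum b n.+1) b k / entry b k).
  move=> kn; apply: (@continuousM R _ (fun b => A_ (psum b n.+1) b k)
    (fun b => (entry b k)^-1)); last first.
    by apply: continuousV; [exact: a_neq0|exact: entry_continuous].
  apply: (@continuousB R R^o _
    (fun b => 2 * psum b n.+1 - 2 * (n%:R - k%:R + 1)) (fun b => psum b k));
    last exact: psum_continuous.
  apply: (@continuousB R R^o _ (fun b => 2 * psum b n.+1));
    last exact: cst_continuous.
  apply: (@continuousM R _ (fun=> 2)); first exact: cst_continuous.
  exact: psum_continuous.
apply: continuous_bigmax => [|k]; first by apply: quotient_continuous; lia.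
by rewrite mem_index_iota; apply: quotient_continuous.
Qed.

Lemma Fn_attained :
  exists x a, [/\ n%:R <= x, calA n x a & Fn R n = Fxa x a].
Proof.
have [e Ae] := calA_nonempty n2 (lexx (n%:R : R)).
pose c : R := n%:R + Fxa n%:R e.
set K := [set a : 'rV[R]_n | calA n (psum a n.+1) a /\ psum a n.+1 <= c].
have Fe0 : 0 <= Fxa n%:R e by have := Fxa_ge Ae; lra.
have Ke : K e by rewrite /K /= (psum_last Ae) /c lerDl.
have F_continuous : {within K, continuous (fun a => Fxa (psum a n.+1) a)}.
  apply: continuous_in_subspaceT => a /set_mem[Aa _].
  apply: Fxa_psum_continuous => k kn.
  by rewrite gt_eqF // (lt_le_trans ltr01) // (entry_ge1 Aa).
have [a /set_mem[Aa _] a_min] :=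
  compact_EVT_min (ex_intro _ e Ke) (@compact_calA_le R n c) F_continuous.
have nx := calA_ge Aa.
exists (psum a n.+1), a; split=> //; apply/eqP; rewrite eq_le Fn_le_Fxa //=.
apply: lb_le_inf; first exact: (Fn_has_inf R n2).1.
move=> _ [x /= /(Fx_min n2)[b Ab [<- _]] <-].
have [xc|cx] := leP x c.
  by rewrite -(psum_last Ab); apply/a_min/mem_set; rewrite /K /= (psum_last Ab).
apply: (@le_trans _ _ (Fxa n%:R e)).
  by rewrite -[X in Fxa X e](psum_last Ae); apply/a_min/mem_set.
by have := Fxa_ge Ab; rewrite /c in cx; lra.
Qed.

Section feasible_point.
Variables (x t : R) (a : 'rV[R]_n) (l : nat).
Hypotheses (Aa : calA n x a) (Ft : Fxa x a <= t) (t0 : 0 < t).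
Hypothesis l_range : (1 <= l <= n)%N.

Let slack_ge0 k : (1 <= k <= n)%N -> 0 <= slack t (x - n%:R) (psum a) k.
Proof. by move: k; apply/Fxa_leP. Qed.

Lemma psum_ge_tight_sum k : (l <= k <= n.+1)%N ->
  tight_sum l (x - n%:R) t k <= psum a k.
Proof.
move=> kn; have kE : k = (l + (k - l))%N by lia.
rewrite -subr_ge0 kE; apply: le_trans (excess_geometric t0 (leqnn l) _).
  have /andP[q0 _] := ratio_exp_itv (k - l) t0.
  rewrite mulr_ge0 ?(ltW q0) // tight_sum_start.
  have := psumB_ge (j := 1) (k := l) Aa ltac:(lia) ltac:(lia).
  by rewrite psum1; lra.
by move=> i ik; apply: slack_ge0; lia.
Qed.

Lemma gap_ge0 : 0 <= gap n l (x - n%:R) t.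
Proof.
rewrite /gap subrK subr_ge0 -[leRHS](psum_last Aa).
by apply: psum_ge_tight_sum; lia.
Qed.

Section tight_point.
Hypothesis gap0 : gap n l (x - n%:R) t = 0.

Lemma psum_eq_tight_sum k : (l <= k <= n.+1)%N ->
  psum a k = tight_sum l (x - n%:R) t k.
Proof.
move=> kn; apply/eqP; rewrite eq_le psum_ge_tight_sum // andbT -subr_le0.
have := @excess_geometric _ l (x - n%:R) t (psum a) k (n.+1 - k) t0.
rewrite subnKC; last lia.
have -> : psum a n.+1 - tight_sum l (x - n%:R) t n.+1 = 0.
  by rewrite (psum_last Aa) -gap0 /gap subrK.
have /andP[q0 _] := ratio_exp_itv (n.+1 - k) t0.
by rewrite pmulr_rle0 //; apply; [lia|move=> i ik; apply: slack_ge0; lia].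
Qed.

Lemma entry_eq1 k : (2 <= k <= l)%N -> entry a k = 1.
Proof.
case: k => // k kl; apply/eqP; rewrite eq_le (entry_ge1 Aa) ?andbT; last lia.
rewrite entry_psum; last lia.
have := psum_eq_tight_sum (k := l) ltac:(lia); rewrite tight_sum_start.
have := psumB_ge (j := k.+1) (k := l) Aa ltac:(lia) ltac:(lia).
have := psumB_ge (j := 1) (k := k) Aa ltac:(lia) ltac:(lia).
by rewrite psum1 -[k.+1%:R]natr1; lra.
Qed.

Lemma A_eq_mul_entry k : (l < k <= n.+1)%N -> A_ x a k = t * entry a k.
Proof.
case: k => // k kn; apply/esym/eqP; rewrite -subr_eq0 -slack_psum; last lia.
rewrite /slack !psum_eq_tight_sum; [|lia|lia].
by apply/eqP/slack_tight_sum => //; lia.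
Qed.

Hypothesis tE : t = 2 * (x - n%:R) + l%:R - 1.

Lemma entry_tail k : (l < k <= n.+1)%N -> entry a k = 2 - ratio t ^+ (k - l).
Proof.
case: k => // k kn; rewrite entry_psum; last lia.
rewrite !psum_eq_tight_sum ?tight_sumS //; try lia.
by rewrite tight_coef_eq // [in RHS]subSn ?exprS //; lia.
Qed.

Lemma tight_point_sum : x = (2 - ratio t ^+ (n.+1 - l)) * t.
Proof.
by move: gap0; rewrite /gap /tight_sum tight_coef_eq // -[n.+1%:R]natr1; lra.
Qed.

End tight_point.
End feasible_point.

Section optimal_point.
Variables (x : R) (a : 'rV[R]_n).
Hypotheses (nx : n%:R <= x) (Aa : calA n x a) (FE : Fn R n = Fxa x a).
Local Notation t := (Fn R n).
Local Notation y := (x - n%:R).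

Lemma optimal_sum_gt : n%:R < x.
Proof.
rewrite lt_neqAle nx andbT; apply/eqP => xn.
have An : calA n n%:R a by rewrite xn.
by have := Fxa_at_n_ge An; rewrite [X in Fxa X]xn -FE leNgt Fn_lt_n.
Qed.

Lemma optimal_index :
  exists2 l, (2 <= l <= n)%N & l%:R - 1 <= t - 2 * y < l%:R.
Proof.
have := optimal_sum_gt; have := Fn_lt_n; have := Fxa_ge Aa; rewrite -FE.
set u := t - 2 * y => u1 tn xn; have u_ge1 : 1 <= u by rewrite /u; lra.
have /andP[lu ul] := truncn_itv (le_trans ler01 u_ge1).
exists (Num.truncn u).+1; last by rewrite -natr1 addrK lu natr1.
rewrite ltnS truncn_gt0 u_ge1 -(ltr_nat R) /=.
by apply: le_lt_trans lu _; rewrite /u; lra.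
Qed.

Lemma optimal_gap l : (2 <= l <= n)%N -> l%:R - 1 <= t - 2 * y <= l%:R ->
  gap n l y t = 0.
Proof.
move=> l_range t_range; have xn := optimal_sum_gt.
apply/eqP; rewrite eq_le gap_Fn_le0 ?subr_gt0 //=.
have := Fxa_ge1 nx Aa; rewrite -FE => t1.
by apply: (gap_ge0 Aa) => //; [rewrite FE|exact: lt_le_trans t1|lia].
Qed.

Lemma optimal_value l : (2 <= l <= n)%N -> l%:R - 1 <= t - 2 * y < l%:R ->
  t = 2 * y + l%:R - 1.
Proof.
move=> l_range /andP[t_range tl]; have xn := optimal_sum_gt.
have gap0 := optimal_gap l_range ltac:(lra).
apply/eqP; apply: contraT => t_neq.
have {}t_range : l%:R - 1 < t - 2 * y.
  rewrite lt_neqAle t_range andbT; apply: contraNN t_neq => /eqP tE.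
  by apply/eqP; lra.
have gapE z : gap n l z t = (z - y) * (2 * ratio t ^+ (n.+1 - l) - 1).
  by rewrite -gapB gap0 subr0.
have [q2|q2|] := ltgtP (ratio t ^+ (n.+1 - l)) (1 / 2).
- pose z := Num.max (y / 2) ((t - l%:R) / 2).
  have zy : z < y by rewrite gt_max; apply/andP; split; lra.
  have z0 : y / 2 <= z by rewrite le_max lexx.
  have zl : (t - l%:R) / 2 <= z by rewrite le_max lexx orbT.
  have := gap_Fn_le0 (y := z) l_range ltac:(lra) ltac:(lra).
  by rewrite gapE nmulr_lle0 ?subr_ge0 ?leNgt ?zy //; lra.
- have := gap_Fn_le0 (y := (t - l%:R + 1) / 2) l_range ltac:(lra) ltac:(lra).
  by rewrite gapE pmulr_lle0; lra.
- by move/(gap_eq0_ratio_exp_neq n2 (andP l_range).2 gap0).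
Qed.

End optimal_point.
End optimum.

Theorem theorem7p1 (R : realType) (n : nat) (hn : (2 <= n)%N) :
  (exists (x : R) (a : 'rV[R]_n),
      [/\ n%:R <= x, calA n x a & Fn R n = Fxa x a]) /\
  (forall (x : R) (a : 'rV[R]_n),
      n%:R <= x -> calA n x a -> Fn R n = Fxa x a ->
      exists l : nat,
        [/\ (2 <= l <= n)%N,
            Fn R n = 2 * (x - n%:R) + l%:R - 1
            /\ (let theta := (Fn R n / (Fn R n + 1)) ^+ (n + 1 - l) in
                x = (2 - theta) * Fn R n),
            (forall k : nat, (2 <= k <= l)%N -> entry a k = 1)
            /\ (forall k : nat, (l <= k <= n + 1)%N ->
                  entry a k = 2 - (Fn R n / (Fn R n + 1)) ^+ (k - l))
          & forall k : nat, (l + 1 <= k <= n + 1)%N ->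
              Fn R n = A_ x a k / entry a k]).
Proof.
split=> [|x a nx Aa FE]; first exact: Fn_attained.
have [l l_range t_range] := optimal_index hn nx Aa FE.
have gap0 : gap n l (x - n%:R) (Fn R n) = 0.
  by apply: (optimal_gap hn nx Aa FE l_range); lra.
have tE := optimal_value hn nx Aa FE l_range t_range.
have Ft : Fxa x a <= Fn R n by rewrite FE.
have t0 : 0 < Fn R n by rewrite FE; exact: lt_le_trans (Fxa_ge1 nx Aa).
have l_le_n : (1 <= l <= n)%N by lia.
have entry_head := entry_eq1 hn Aa Ft t0 l_le_n gap0.
exists l; split=> //.
- by split=> //=; rewrite addn1; exact: tight_point_sum gap0 tE.
- split=> // k kn; have [kl|lk] := leqP k l.
    have -> : k = l by lia.
    by rewrite entry_head ?subnn ?expr0; [lra|lia].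
  by apply: (entry_tail hn Aa Ft t0 l_le_n gap0 tE); lia.
- move=> k kn.
  rewrite (A_eq_mul_entry hn Aa Ft t0 l_le_n gap0) ?mulfK //; last lia.
  by rewrite gt_eqF // (lt_le_trans ltr01) // (entry_ge1 Aa) //; lia.
Qed.
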